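(* Let $J$ be a finite index set and let $f$ be a feasible and clean positive polynomial system (PPS) indexed by $J$. Then $f$ is non-singular if and only if there exists $u \in \mathbb{R}_{>0}^J$ with $f(u) \prec u$ (and thus $\mu f \prec u$). In this case, there exists a rational such $u$ arbitrarily close to $\mu f$: for every $\varepsilon > 0$ there exists $u \in \mathbb{Q}_{>0}^J$ such that $f(u) \prec u$ and $\|\mu f - u\|_\infty < \varepsilon$.
   Context: A positive polynomial system (PPS) over variables $x = (x_j)_{j\in J}$, $J$ finite, is a vector $f = (f_j)_{j \in J}$ of multivariate polynomials in $x$ with coefficients in $\mathbb{R}_{\ge 0}$. It induces a monotone function $f\colon [0,\infty]^J \to [0,\infty]^J$ (with $0\cdot\infty = 0$), which has a least fixed point $\mu f \in [0,\infty]^J$ with respect to the component-wise order $\le$. For vectors, $u \prec v$ means $u_j < v_j$ for all $j \in J$. The PPS $f$ is feasible if $\mu f \in \mathbb{R}_{\ge 0}^J$, and clean if $(\mu f)_j > 0$ for all $j \in J$. $f'(u)$ denotes the Jacobi matrix $(\partial f_i/\partial x_j)_{i,j\in J}$ evaluated at $u$. A feasible PPS $f$ is non-singular if the matrix $I - f'(\mu f)$ is invertible. *)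

(* Defs.v *)
From mathcomp Require Import all_boot all_order all_algebra.
From mathcomp Require Import mpoly.
From mathcomp Require Import boolp classical_sets reals constructive_ereal.
(* Required without Import: its notations clash with those of mpoly. *)
From mathcomp Require ereal.

Set Implicit Arguments.
Unset Strict Implicit.
Unset Printing Implicit Defensive.

Import Order.TTheory GRing.Theory Num.Theory.

Local Open Scope ring_scope.

Definition vle (R : realType) (J : finType) (u v : J -> \bar R) : Prop :=
  forall j, (u j <= v j)%E.

Definition vlt (R : realType) (J : finType) (u v : J -> \bar R) : Prop :=
  forall j, (u j < v j)%E.

(* Variables are indexed by an arbitrary finite type [J]; since [{mpoly R[n]}]
   has its variables indexed by ['I_n], the variable x_j is encoded as
   ['X_(enum_rank j)], so that ['X_i] stands for x_(enum_val i). *)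
Record pps (R : realType) (J : finType) := PPS {
  pps_poly :> J -> {mpoly R[#|J|]};
  pps_coef_ge0 : forall j m, 0 <= (pps_poly j)@_m
}.

(* The map [0,oo]^J -> [0,oo]^J induced by [f]. It cannot be [meval], which
   only evaluates in rings; products in [\bar R] satisfy [0 * +oo = 0]. *)
Definition pps_map (R : realType) (J : finType) (f : pps R J)
    (u : J -> \bar R) : J -> \bar R :=
  fun j => (\sum_(m <- msupp (f j))
              ((f j)@_m)%:E * \prod_(i < #|J|) u (enum_val i) ^+ m i)%E.

Definition is_lfp (R : realType) (J : finType) (f : pps R J)
    (v : J -> \bar R) : Prop :=
  [/\ vle (fun=> 0%E) v,
      pps_map f v = v
    & forall w, vle (fun=> 0%E) w -> pps_map f w = w -> vle v w].

(* The default value is irrelevant: see [lfpP]. *)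
Definition lfp (R : realType) (J : finType) (f : pps R J) : J -> \bar R :=
  xget (fun=> 0%E) (fun v => is_lfp f v).

Definition feasible (R : realType) (J : finType) (f : pps R J) : Prop :=
  forall j, lfp f j \is a fin_num.

Definition clean (R : realType) (J : finType) (f : pps R J) : Prop :=
  vlt (fun=> 0%E) (lfp f).

Definition jacobian (R : realType) (J : finType) (f : pps R J) (u : J -> R) :
    'M[R]_#|J| :=
  \matrix_(i, j) ((f (enum_val i))^`M(j)).@[fun k => u (enum_val k)].

Definition nonsingular (R : realType) (J : finType) (f : pps R J) : Prop :=
  feasible f /\ 1%:M - jacobian f (fun j => fine (lfp f j)) \in unitmx.

Definition sup_norm (R : realType) (J : finType) (u : J -> R) : R :=
  \big[Num.max/0]_(j : J) `|u j|.

Lemma pps_map_ge0 (R : realType) (J : finType) (f : pps R J)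
    (u : J -> \bar R) :
  vle (fun=> 0%E) u -> vle (fun=> 0%E) (pps_map f u).
Proof.
move=> u0 j; apply: sume_ge0 => m _; apply: mule_ge0.
  by rewrite lee_fin pps_coef_ge0.
by apply: prode_ge0 => i _; apply: expe_ge0; apply: u0.
Qed.

Lemma pps_map_mono (R : realType) (J : finType) (f : pps R J)
    (u v : J -> \bar R) :
  vle (fun=> 0%E) u -> vle u v -> vle (pps_map f u) (pps_map f v).
Proof.
move=> u0 uv j; apply: lee_sum => m _; apply: lee_wpmul2l.
  by rewrite lee_fin pps_coef_ge0.
have expE (x y : \bar R) n : (0 <= x -> x <= y -> x ^+ n <= y ^+ n)%E.
  move=> x0 xy; elim: n => [|n IH]; first by rewrite !expe0.
  by rewrite !expeS; apply: lee_pmul => //; apply: expe_ge0.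
suff [] : (0 <= \prod_(i < #|J|) u (enum_val i) ^+ m i /\
  \prod_(i < #|J|) u (enum_val i) ^+ m i <=
  \prod_(i < #|J|) v (enum_val i) ^+ m i)%E by [].
elim/big_ind2 : _ => [//|x1 x2 y1 y2 [x10 x12] [y10 y12]|i _].
  by split; [exact: mule_ge0|exact: lee_pmul].
by split; [apply: expe_ge0; exact: u0|apply: expE; [exact: u0|exact: uv]].
Qed.

Lemma pps_map_EFin (R : realType) (J : finType) (f : pps R J) (u : J -> R) j :
  pps_map f (fun j => (u j)%:E) j = ((f j).@[fun k => u (enum_val k)])%:E.
Proof.
rewrite /pps_map mevalE -sumEFin; apply: eq_bigr => m _.
rewrite EFinM -prodEFin; congr (_ * _)%E; apply: eq_bigr => i _.
by rewrite EFin_expe.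
Qed.

Lemma lfp_exists (R : realType) (J : finType) (f : pps R J) :
  exists v, is_lfp f v.
Proof.
pose S v := vle (fun=> 0%E) v /\ vle (pps_map f v) v.
pose mu j : \bar R := ereal.ereal_inf (fun x => exists2 v, S v & v j = x).
have mu_le v : S v -> vle mu v.
  by move=> Sv j; apply: ereal.ereal_inf_lbound; exists v.
have mu0 : vle (fun=> 0%E) mu.
  by move=> j; apply: ereal.le_ereal_inf_tmp => _ [v [v0 _] <-]; apply: v0.
have fmu_le : vle (pps_map f mu) mu.
  move=> j; apply: ereal.le_ereal_inf_tmp => _ [v [v0 fv] <-].
  by apply: (le_trans _ (fv j)); apply: pps_map_mono => //; apply: mu_le.
exists mu; split=> //.
- apply/funext => j; apply/eqP; rewrite eq_le fmu_le /=.
  apply: mu_le; split; first exact: pps_map_ge0.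
  by apply: pps_map_mono => //; apply: pps_map_ge0.
- move=> w w0 fw; apply: mu_le; split=> // j.
  by rewrite fw.
Qed.

Lemma lfpP (R : realType) (J : finType) (f : pps R J) : is_lfp f (lfp f).
Proof. by have [v fv] := lfp_exists f; exact: (xgetPex _ (ex_intro _ v fv)). Qed.

(* Main.v *)
(** Write [mu] for the least fixed point and [A] for the Jacobian of [f] at
    [mu].  Everything rests on the fact that [mu] lies below every
    nonnegative [v] with [f v <= v].

    If [f u < u], then [mu = f mu <= f u < u], and since [f] has nonnegative
    coefficients [f u >= mu + A (u - mu)]; so [h = u - mu] is positive with
    [A h < h], and a nonnegative matrix contracting a positive vector in this
    sense has no eigenvector for the eigenvalue 1.

    Conversely, if [I - A] is invertible, let [d] solve [(I - A) d = 1].  This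
    [d] is nonnegative, without any appeal to Perron-Frobenius theory: its
    negative part [n] satisfies [A n >= n + 1] on the support of [n], so if [n]
    were not zero, [f (mu - s n) <= mu - s A n + O(s^2) <= mu - s n] for small
    [s > 0] would contradict the minimality of [mu].  Hence
    [d = 1 + A d >= 1], and [f (mu + s d) <= mu + s (d - 1) + O(s^2)] is less
    than [mu + s (d - 1/2)] for small [s > 0].  By monotonicity every [u]
    strictly between [mu + s (d - 1/2)] and [mu + s d] satisfies [f u < u], and
    there are rational ones. *)

Require Import Defs.
From mathcomp Require Import all_boot all_order all_algebra.
From mathcomp Require Import mpoly.
From mathcomp Require Import boolp classical_sets reals constructive_ereal.
From mathcomp Require ereal.
From mathcomp Require Import ring lra.

Import Order.TTheory GRing.Theory Num.Theory.

Local Open Scope ring_scope.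

Set Implicit Arguments.
Unset Strict Implicit.

(** * First-order expansion of multivariate polynomials *)

(** The predicate [K] lets the induction stay among polynomials with nonnegative coefficients; 0 and
    1 are separate cases because [K] need not hold of them. *)
Lemma mpoly_ring_ind (R : comNzRingType) (n : nat) (K : R -> Prop)
    (P : {mpoly R[n]} -> Prop) :
  P 0 -> P 1 -> (forall c, K c -> P c%:MP) -> (forall i, P 'X_i) ->
  (forall p q, P p -> P q -> P (p + q)) ->
  (forall p q, P p -> P q -> P (p * q)) ->
  forall p, (forall m, K p@_m) -> P p.
Proof.
move=> P0 P1 PC PX PD PM p Kp; rewrite [p]mpolyE.
apply: big_ind => // m _; rewrite -mul_mpolyC; apply: (PM); first exact: PC.
rewrite mpolyXE_id; apply: big_ind => // i _.
elim: (m i) => [|k IH]; first by rewrite expr0.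
by rewrite exprS; apply: PM.
Qed.

(** The directional derivative of [p] at [x] along [h]. *)
Definition dmeval (R : comNzRingType) (n : nat) (x h : 'I_n -> R)
    (p : {mpoly R[n]}) : R :=
  \sum_j (p^`M(j)).@[x] * h j.

Section Differential.
Variables (R : comNzRingType) (n : nat) (x h : 'I_n -> R).

Lemma dmevalC c : dmeval x h c%:MP = 0.
Proof. by apply: big1 => j _; rewrite mderivC meval0 mul0r. Qed.

Lemma dmevalX i : dmeval x h 'X_i = h i.
Proof.
rewrite /dmeval (bigD1 i) //= mderivX mnm1E eqxx mevalZ.
rewrite -[X in (X - _)%MM]add0m addmK mpolyX0 meval1 !mul1r big1 ?addr0 // => j ji.
by rewrite mderivX mnm1E eq_sym (negbTE ji) scale0r meval0 mul0r.
Qed.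

Lemma dmevalD p q : dmeval x h (p + q) = dmeval x h p + dmeval x h q.
Proof.
rewrite /dmeval -big_split /=; apply: eq_bigr => j _.
by rewrite mderivD mevalD mulrDl.
Qed.

Lemma dmevalM p q :
  dmeval x h (p * q) = dmeval x h p * q.@[x] + p.@[x] * dmeval x h q.
Proof.
rewrite /dmeval mulr_suml mulr_sumr -big_split /=; apply: eq_bigr => j _.
by rewrite mderivM mevalD !mevalM; ring.
Qed.

(** The remainder is itself a polynomial in [s], hence bounded on [0,1]. *)
Lemma meval_taylor p : exists r : {poly R}, forall s,
  p.@[fun k => x k + s * h k] = p.@[x] + s * dmeval x h p + s ^+ 2 * r.[s].
Proof.
elim/(@mpoly_ring_ind R n (fun=> True)): p => //.
- by exists 0 => s; rewrite horner0 -mpolyC0 dmevalC !mevalC; ring.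
- by exists 0 => s; rewrite horner0 -mpolyC1 dmevalC !mevalC; ring.
- by move=> c _; exists 0 => s; rewrite horner0 dmevalC !mevalC; ring.
- by move=> i; exists 0 => s; rewrite horner0 dmevalX !mevalXU; ring.
- move=> p q [r Hr] [r' Hr']; exists (r + r') => s.
  by rewrite dmevalD !mevalD Hr Hr' hornerD; ring.
- move=> p q [r Hr] [r' Hr'].
  exists ((dmeval x h p * dmeval x h q)%:P + p.@[x]%:P * r' + q.@[x]%:P * r
    + 'X * ((dmeval x h p)%:P * r' + (dmeval x h q)%:P * r)
    + 'X ^+ 2 * r * r') => s.
  by rewrite dmevalM !mevalM Hr Hr' !hornerE; ring.
Qed.

End Differential.

Lemma meval_tangent (R : realFieldType) (n : nat) (x h : 'I_n -> R)
    (p : {mpoly R[n]}) :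
  (forall i, 0 <= x i) -> (forall i, 0 <= h i) -> (forall m, 0 <= p@_m) ->
  p.@[x] + dmeval x h p <= p.@[fun k => x k + h k].
Proof.
move=> x0 h0 p0.
(* The two signs are carried along for the product case, where expanding the product of the two
   tangents leaves the extra term [dmeval x h p * dmeval x h q], which is nonnegative. *)
suff [] : [/\ 0 <= p.@[x], 0 <= dmeval x h p &
  p.@[x] + dmeval x h p <= p.@[fun k => x k + h k]] by [].
move: p p0; apply: (@mpoly_ring_ind R n (fun c => 0 <= c)).
- by rewrite -mpolyC0 dmevalC !mevalC addr0 !lexx.
- by rewrite -mpolyC1 dmevalC !mevalC addr0 !lexx ler01.
- by move=> c c0; rewrite dmevalC !mevalC addr0 !lexx c0.
- by move=> i; rewrite dmevalX !mevalXU !lexx x0 h0.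
- move=> p q [p0 dp0 hp] [q0 dq0 hq]; rewrite dmevalD !mevalD.
  by split; lra.
- move=> p q [p0 dp0 hp] [q0 dq0 hq]; rewrite dmevalM !mevalM.
  split; [exact: mulr_ge0|by rewrite addr_ge0 // mulr_ge0|].
  apply: (le_trans _ (ler_pM _ _ hp hq)); [|lra|lra].
  by have := mulr_ge0 dp0 dq0; nra.
Qed.

(** * Nonnegative matrices that contract a positive vector *)

(** In the maximum norm weighted by [d], [A] strictly shrinks every nonzero vector, so it fixes
    none. Transposing first turns the row vector given by [det0P] into a right eigenvector. *)
Lemma unitmx_sub_contraction (R : realFieldType) (n : nat) (A : 'M[R]_n)
    (d : 'I_n -> R) :
  (forall i j, 0 <= A i j) -> (forall i, 0 < d i) ->
  (forall i, \sum_j A i j * d j < d i) -> 1%:M - A \in unitmx.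
Proof.
move=> A0 d0 Ad; rewrite -unitmx_tr unitmxE unitfE.
apply/det0P => -[v v0 vA].
have Av i : v 0 i = \sum_j A i j * v 0 j.
  move/matrixP/(_ 0 i): vA; rewrite linearB /= trmx1 mulmxBr mulmx1 !mxE.
  move/eqP; rewrite subr_eq0 => /eqP ->.
  by apply: eq_bigr => j _; rewrite !mxE mulrC.
(* This coordinate provides a starting index for the maximum and makes the maximum [t] positive. *)
have [k vk] : exists k, v 0 k != 0.
  apply/existsP; apply: contraNT v0 => /existsPn v0.
  by apply/eqP/rowP => k; rewrite mxE; apply/eqP/negPn/v0.
have [i _ imax] := @arg_maxP _ _ _ k xpredT (fun i => `|v 0 i| / d i) isT.
set t := `|v 0 i| / d i in imax.
have tmax j : `|v 0 j| <= t * d j by rewrite -ler_pdivrMr //; exact: imax.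
have t0 : 0 < t.
  by apply: (lt_le_trans _ (imax k isT)); rewrite divr_gt0 ?normr_gt0.
have : `|v 0 i| < t * d i.
  rewrite {1}Av; apply: (le_lt_trans (ler_norm_sum _ _ _)).
  apply: (@le_lt_trans _ _ (t * \sum_j A i j * d j)); last by rewrite ltr_pM2l.
  rewrite mulr_sumr; apply: ler_sum => j _.
  by rewrite normrM (ger0_norm (A0 i j)) mulrCA ler_wpM2l.
by rewrite /t divfK ?ltxx // gt_eqF.
Qed.

Lemma finite_ub (R : realFieldType) (I : finType) (g : I -> R) :
  exists2 C, 0 <= C & forall i, g i <= C.
Proof.
exists (\sum_i `|g i|) => [|i]; first exact: sumr_ge0.
rewrite (bigD1 i) //= (le_trans (ler_norm _)) // lerDl.
exact: sumr_ge0.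
Qed.

(** * Real-valued evaluation and differential of a PPS *)

Section PPS.
Variables (R : realType) (J : finType) (f : pps R J).

(** [lfp] is minimal only among fixed points by definition. As in Knaster-Tarski, the infimum [nu]
    of all prefixed points is itself a fixed point, so [lfp f] lies below it. *)
Lemma lfp_le_prefixpoint (v : J -> \bar R) :
  vle (fun=> 0%E) v -> vle (pps_map f v) v -> vle (lfp f) v.
Proof.
pose S v := vle (fun=> 0%E) v /\ vle (pps_map f v) v.
pose nu j : \bar R := ereal.ereal_inf [set w j | w in S].
have nu_le w : S w -> vle nu w.
  by move=> Sw j; apply: ereal.ereal_inf_lbound; exists w.
have nu0 : vle (fun=> 0%E) nu.
  by move=> j; apply: ereal.le_ereal_inf_tmp => _ [w [w0 _] <-]; apply: w0.
have fnu_le : vle (pps_map f nu) nu.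
  move=> j; apply: ereal.le_ereal_inf_tmp => _ [w Sw <-].
  by apply: (le_trans _ (Sw.2 j)); apply: pps_map_mono => //; apply: nu_le.
have fnu : pps_map f nu = nu.
  apply/funext => j; apply/eqP; rewrite eq_le fnu_le /=.
  apply: nu_le; split; first exact: pps_map_ge0.
  by apply: pps_map_mono => //; apply: pps_map_ge0.
move=> v0 fv j; have [_ _ lfp_min] := lfpP f.
exact: le_trans (lfp_min _ nu0 fnu j) (nu_le v (conj v0 fv) j).
Qed.

Definition pps_eval (u : J -> R) (j : J) : R :=
  (f j).@[fun k => u (enum_val k)].

Definition pps_diff (x h : J -> R) (j : J) : R :=
  dmeval (fun k => x (enum_val k)) (fun k => h (enum_val k)) (f j).

Lemma pps_eval_mono (u v : J -> R) :
  (forall j, 0 <= u j) -> (forall j, u j <= v j) ->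
  forall j, pps_eval u j <= pps_eval v j.
Proof.
move=> u0 uv j; rewrite -lee_fin -!pps_map_EFin.
by apply: pps_map_mono => k; rewrite lee_fin.
Qed.

Lemma vlt_pps_map_EFin (u : J -> R) :
  vlt (pps_map f (fun j => (u j)%:E)) (fun j => (u j)%:E) <->
  forall j, pps_eval u j < u j.
Proof.
by split=> fu j; move: (fu j); rewrite pps_map_EFin lte_fin.
Qed.

Lemma pps_eval_tangent (x h : J -> R) j :
  (forall j, 0 <= x j) -> (forall j, 0 <= h j) ->
  pps_eval x j + pps_diff x h j <= pps_eval (fun j => x j + h j) j.
Proof. by move=> x0 h0; apply: meval_tangent => // m; apply: pps_coef_ge0. Qed.

(** Compactness of [0,1] bounds each remainder, and finiteness of [J] makes the bound uniform. *)
Lemma pps_eval_taylor (x h : J -> R) : exists2 C, 0 <= C &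
  forall j s, 0 <= s <= 1 ->
  pps_eval (fun j => x j + s * h j) j <=
    pps_eval x j + s * pps_diff x h j + s ^+ 2 * C.
Proof.
have taylor j : exists C, forall s, 0 <= s <= 1 ->
    pps_eval (fun j => x j + s * h j) j <=
      pps_eval x j + s * pps_diff x h j + s ^+ 2 * C.
  have [r rE] := meval_taylor (fun k => x (enum_val k))
    (fun k => h (enum_val k)) (f j).
  have [C rC] := poly_itv_bound r 0 1.
  exists C => s s01; rewrite /pps_eval rE lerD2l ler_wpM2l ?sqr_ge0 //.
  exact: le_trans (ler_norm _) (rC s s01).
have [g gP] := choice taylor; have [C C0 gC] := finite_ub g.
exists C => // j s s01; apply: (le_trans (gP j s s01)).
by rewrite lerD2l ler_wpM2l ?sqr_ge0.
Qed.

Lemma pps_diffE (x h : J -> R) k :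
  pps_diff x h (enum_val k) = \sum_l jacobian f x k l * h (enum_val l).
Proof. by apply: eq_bigr => l _; rewrite mxE. Qed.

Lemma jacobian_ge0 (x : J -> R) k l :
  (forall j, 0 <= x j) -> 0 <= jacobian f x k l.
Proof.
move=> x0; rewrite mxE mevalE; apply: sumr_ge0 => m _; apply: mulr_ge0.
  by rewrite mcoeff_deriv mulrn_wge0 // pps_coef_ge0.
by apply: prodr_ge0 => i _; apply: exprn_ge0.
Qed.

Lemma pps_diff_mono (x h h' : J -> R) j :
  (forall j, 0 <= x j) -> (forall j, h j <= h' j) ->
  pps_diff x h j <= pps_diff x h' j.
Proof.
move=> x0 hh'; rewrite -(enum_rankK j) !pps_diffE.
by apply: ler_sum => l _; rewrite ler_wpM2l ?jacobian_ge0.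
Qed.

Lemma pps_diffN (x h : J -> R) j :
  pps_diff x (fun j => - h j) j = - pps_diff x h j.
Proof.
by rewrite /pps_diff /dmeval -sumrN; apply: eq_bigr => l _; rewrite mulrN.
Qed.

(** * Behaviour near the least fixed point *)

Section LeastFixedPoint.
Hypotheses (f_feasible : feasible f) (f_clean : clean f).
Let mu j : R := fine (lfp f j).

Lemma fine_lfpK j : (mu j)%:E = lfp f j.
Proof. exact: fineK. Qed.

Lemma fine_lfp_gt0 j : 0 < mu j.
Proof. by rewrite -lte_fin fine_lfpK. Qed.

Lemma pps_eval_lfp j : pps_eval mu j = mu j.
Proof.
apply: EFin_inj; rewrite -pps_map_EFin fine_lfpK.
have -> : (fun j => (mu j)%:E) = lfp f by apply/funext => k; exact: fine_lfpK.
by have [_ -> _] := lfpP f.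
Qed.

Lemma fine_lfp_le (v : J -> R) :
  (forall j, 0 <= v j) -> (forall j, pps_eval v j <= v j) ->
  forall j, mu j <= v j.
Proof.
move=> v0 fv j; rewrite -lee_fin fine_lfpK.
apply: (@lfp_le_prefixpoint (fun j => (v j)%:E)) => k; rewrite ?lee_fin //.
by rewrite pps_map_EFin lee_fin; exact: fv.
Qed.

Lemma fine_lfp_lt (u : J -> R) :
  (forall j, 0 < u j) -> (forall j, pps_eval u j < u j) ->
  forall j, mu j < u j.
Proof.
move=> u0 fu j.
have mu_le := fine_lfp_le (fun j => ltW (u0 j)) (fun j => ltW (fu j)).
rewrite -pps_eval_lfp; apply: le_lt_trans (fu j).
by apply: pps_eval_mono => // k; exact/ltW/fine_lfp_gt0.
Qed.

Lemma nonsingular_of_prefixpoint (u : J -> R) :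
  (forall j, 0 < u j) -> (forall j, pps_eval u j < u j) -> nonsingular f.
Proof.
move=> u0 fu; split=> //.
have mu0 j : 0 <= mu j by exact/ltW/fine_lfp_gt0.
have mu_lt := fine_lfp_lt u0 fu.
apply: (@unitmx_sub_contraction _ _ _
  (fun k => u (enum_val k) - mu (enum_val k))) => [k l|k|k].
- exact: jacobian_ge0.
- by rewrite subr_gt0.
rewrite -(pps_diffE mu (fun j => u j - mu j)).
have := @pps_eval_tangent mu (fun j => u j - mu j) (enum_val k) mu0
  (fun j => ltW (etrans (subr_gt0 _ _) (mu_lt j))).
have -> : (fun j => mu j + (u j - mu j)) = u by apply/funext => j; ring.
by rewrite pps_eval_lfp; have := fu (enum_val k); lra.
Qed.

Lemma lfp_no_expanding_direction (h : J -> R) :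
  (forall j, 0 <= h j) ->
  (forall j, 0 < h j -> h j + 1 <= pps_diff mu h j) ->
  forall j, h j = 0.
Proof.
move=> h0 Ah.
have [C C0 taylor] := pps_eval_taylor mu (fun j => - h j).
have [K K0 hK] := finite_ub (fun j => h j / mu j).
(* Three constraints at once: [s <= 1] for the Taylor bound, [s * C <= 1] to absorb the remainder in
   the gain of 1, and [s * K <= 1] to keep [mu - s h] nonnegative. *)
pose s := (1 + C + K)^-1.
have s0 : 0 < s by rewrite invr_gt0; lra.
have sE : s * (1 + C + K) = 1 by rewrite mulVf // gt_eqF //; lra.
have s1 : s <= 1 by have := mulr_ge0 (ltW s0) (addr_ge0 C0 K0); lra.
have sC : s * C <= 1 by have := mulr_ge0 (ltW s0) K0; lra.
have sK : s * K <= 1 by have := mulr_ge0 (ltW s0) C0; lra.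
have sh_le j : s * h j <= mu j.
  have := fine_lfp_gt0 j => mu0.
  move: (hK j); rewrite ler_pdivrMr // => hKj.
  apply: (@le_trans _ _ (s * (K * mu j))); first by rewrite ler_pM2l.
  by rewrite mulrA ler_piMl // ltW.
have v0 j : 0 <= mu j + s * - h j by have := sh_le j; lra.
have v_le j : mu j + s * - h j <= mu j.
  by have := mulr_ge0 (ltW s0) (h0 j); lra.
have fv j : pps_eval (fun j => mu j + s * - h j) j <= mu j + s * - h j.
  (* Off the support of [h] the coordinate is still that of [mu], and monotonicity suffices; on the
     support the expansion hypothesis applies. *)
  have := h0 j; rewrite le_eqVlt => /orP[/eqP hj|hj].
    by rewrite -hj oppr0 mulr0 addr0 -[leRHS]pps_eval_lfp; exact: pps_eval_mono.
  apply: (le_trans (taylor j s _)); first by rewrite ltW.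
  rewrite pps_eval_lfp pps_diffN -addrA lerD2l expr2 -mulrA -mulrDr ler_pM2l //.
  by have := Ah j hj; lra.
move=> j; apply/eqP; rewrite eq_le h0 andbT.
have := fine_lfp_le v0 fv j.
by rewrite lerDl mulrN oppr_ge0 pmulr_rle0.
Qed.

Lemma nonsingular_direction : nonsingular f ->
  exists2 d : J -> R, (forall j, 1 <= d j) &
    forall j, pps_diff mu d j = d j - 1.
Proof.
move=> [_ A_unit]; set A := jacobian f _ in A_unit.
have [D DE] : exists D : 'cV[R]_#|J|, (1%:M - A) *m D = const_mx 1.
  by exists (invmx (1%:M - A) *m const_mx 1); exact: mulKVmx.
pose d j := D (enum_rank j) 0.
have dE j : pps_diff mu d j = d j - 1.
  rewrite -[in LHS](enum_rankK j) pps_diffE.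
  move/matrixP/(_ (enum_rank j) 0): DE; rewrite mulmxBl mul1mx !mxE -/(d j) => dj.
  have -> : \sum_l jacobian f mu (enum_rank j) l * d (enum_val l) =
      \sum_l A (enum_rank j) l * D l 0.
    by apply: eq_bigr => l _; rewrite /d enum_valK.
  by lra.
have mu0 j : 0 <= mu j by exact/ltW/fine_lfp_gt0.
(* Where [d j < 0], the negative part dominates [- d], and the differential along [- d] equals
   [- d j + 1]. *)
have n0 j : Num.max (- d j) 0 = 0.
  apply: (lfp_no_expanding_direction (h := fun j => Num.max (- d j) 0)) => {}j.
    by rewrite le_max lexx orbT.
  rewrite lt_max ltxx orbF => dj; rewrite (max_l (ltW dj)).
  apply: (@le_trans _ _ (pps_diff mu (fun j => - d j) j)).
    by rewrite pps_diffN dE; lra.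
  by apply: pps_diff_mono => // k; rewrite le_max lexx.
have d0 j : 0 <= d j.
  by rewrite -oppr_le0 -(n0 j) le_max lexx.
exists d => // j; rewrite -subr_ge0 -dE.
rewrite -(enum_rankK j) pps_diffE; apply: sumr_ge0 => l _.
by rewrite mulr_ge0 ?jacobian_ge0.
Qed.

Lemma rational_prefixpoint (eps : R) : nonsingular f -> 0 < eps ->
  exists u : J -> rat,
    [/\ forall j, mu j < ratr (u j),
        forall j, pps_eval (fun j => ratr (u j)) j < ratr (u j)
      & forall j, ratr (u j) < mu j + eps].
Proof.
move=> /nonsingular_direction[d d1 dE] eps0.
have [C C0 taylor] := pps_eval_taylor mu d.
have [K K0 dK] := finite_ub (fun j => d j / eps).
(* The factor 2 makes the remainder cost less than half of the gain of 1, leaving an open interval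
   for [u]; [K] keeps [s * d j] below [eps]. *)
pose s := (1 + 2 * C + K)^-1.
have s0 : 0 < s by rewrite invr_gt0; lra.
have sE : s * (1 + 2 * C + K) = 1 by rewrite mulVf // gt_eqF //; lra.
have s1 : s <= 1 by have := mulr_ge0 (ltW s0) (addr_ge0 (addr_ge0 C0 C0) K0); lra.
have sC : s * C < 1 / 2 by have := mulr_ge0 (ltW s0) K0; lra.
have sK : s * K < 1 by have := mulr_ge0 (ltW s0) C0; lra.
have sd_lt j : s * d j < eps.
  move: (dK j); rewrite ler_pdivrMr // => dKj.
  apply: (@le_lt_trans _ _ (s * (K * eps))); first by rewrite ler_pM2l.
  by rewrite mulrA gtr_pMl.
have rat_between j : exists q : rat,
    mu j + s * (d j - 1 / 2) < ratr q < mu j + s * d j.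
  have [|q] := @rat_in_itvoo R (mu j + s * (d j - 1 / 2)) (mu j + s * d j).
    by rewrite ltrD2l ltr_pM2l //; lra.
  by rewrite in_itv => q_itv; exists q.
have [u uP] := choice rat_between.
have mu_lt j : mu j < ratr (u j).
  have /andP[lo _] := uP j; apply: lt_trans lo.
  by rewrite ltrDl mulr_gt0 //; have := d1 j; lra.
exists u; split=> // j; have /andP[lo hi] := uP j; last first.
  by apply: (lt_trans hi); rewrite ltrD2l.
(* The upper ends of the intervals bound [f u] by monotonicity; the lower ends bound [u] from
   below. *)
apply: (le_lt_trans _ lo).
apply: (@le_trans _ _ (pps_eval (fun j => mu j + s * d j) j)).
  apply: pps_eval_mono => k; last by have /andP[_ /ltW] := uP k.
  by rewrite (le_trans _ (ltW (mu_lt k))) // ltW // fine_lfp_gt0.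
apply: (le_trans (taylor j s _)); first by rewrite ltW.
rewrite pps_eval_lfp dE -addrA lerD2l expr2 -mulrA -mulrDr ler_pM2l //.
by lra.
Qed.

End LeastFixedPoint.
End PPS.

Theorem theorem4 (R : realType) (J : finType) (f : pps R J) :
  feasible f -> clean f ->
  [/\ nonsingular f <->
        exists u : J -> R, (forall j, 0 < u j) /\
          vlt (pps_map f (fun j => (u j)%:E)) (fun j => (u j)%:E),
      forall u : J -> R, (forall j, 0 < u j) ->
        vlt (pps_map f (fun j => (u j)%:E)) (fun j => (u j)%:E) ->
        vlt (lfp f) (fun j => (u j)%:E)
    & nonsingular f -> forall eps : R, 0 < eps ->
        exists u : J -> rat,
          [/\ forall j, 0 < u j,
              vlt (pps_map f (fun j => (ratr (u j))%:E))
                  (fun j => (ratr (u j))%:E)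
            & sup_norm (fun j => fine (lfp f j) - ratr (u j)) < eps]].
Proof.
move=> ff fc; have mu0 := fine_lfp_gt0 ff fc; split.
- split=> [fns|[u [u0 /vlt_pps_map_EFin fu]]]; last first.
    exact: nonsingular_of_prefixpoint fu.
  have [u [mu_lt fu _]] := rational_prefixpoint ff fc fns ltr01.
  exists (fun j => ratr (u j)); split; last exact/vlt_pps_map_EFin.
  by move=> j; apply: lt_trans (mu_lt j).
- move=> u u0 /vlt_pps_map_EFin fu j.
  by rewrite -fine_lfpK // lte_fin; apply: fine_lfp_lt.
- move=> fns eps eps0.
  have [u [mu_lt fu u_lt]] := rational_prefixpoint ff fc fns eps0.
  exists u; split; last 2 first.
  + exact/(vlt_pps_map_EFin f (fun j => ratr (u j))).
  (* The default 0 of the maximum is below [eps], which covers an empty [J]. *)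
  + apply: bigmax_lt => // j _; rewrite distrC gtr0_norm ?subr_gt0 //.
    by rewrite ltrBlDl.
  + by move=> j; rewrite -(ltr0q R); apply: lt_trans (mu_lt j).
Qed.
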